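(* Let $d\in\mathbb{N}$, $p\in[1,\infty]$, and for $n\in\mathbb{N}$ let $\vec a_n\in\mathbb{R}^d$, $b_n\in\mathbb{R}$ and $L_n(\vec\theta)=\vec a_n\cdot\vec\theta+b_n$ for $\vec\theta\in\mathbb{R}^d$. Put $R_n=|\vec a_n|_p$ and assume $0<R_1\le R_2\le\cdots$. Let $f,h:[1,\infty)\to(0,\infty)$ be non-decreasing functions with $h(x)\ge x$ for all $x\ge1$, and assume $$\lim_{x\to\infty}f(x)=\infty,\qquad \sup_{x\ge1}\int_x^{h(x)}\frac{du}{f(u)}<\infty,\qquad \liminf_{n\to\infty}\frac{R_{\lfloor h(n)\rfloor}}{n f(n) R_n}>0.$$ Then the set $\{\vec\theta\in\mathbb{R}^d:\ \inf_{n\in\mathbb{N}}\left(\|L_n(\vec\theta)\|\cdot f(n)\right)>0\}$ has the cardinality of the continuum. In addition, the set $\{\vec\theta\in\mathbb{R}^d:\ \liminf_{n\to\infty}\left(\|L_n(\vec\theta)\|\cdot f(n)\right)>0\}$ is everywhere dense in $\mathbb{R}^d$.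
   Context: For $x\in\mathbb{R}$, $\|x\|=\min_{k\in\mathbb{Z}}|x-k|$ is the distance to the nearest integer. For $\vec a=(a_1,\dots,a_d)\in\mathbb{R}^d$, $|\vec a|_p=(\sum_{i=1}^d|a_i|^p)^{1/p}$ for $p<\infty$ and $|\vec a|_\infty=\max_i|a_i|$. *)

(* Defs.v *)
From HB Require Import structures.
From mathcomp Require Import all_boot all_order all_algebra.
From mathcomp Require Import all_classical all_reals all_analysis.
Import Order.TTheory GRing.Theory Num.Theory.
Import numFieldNormedType.Exports.

Set Implicit Arguments.
Unset Strict Implicit.
Unset Printing Implicit Defensive.

Local Open Scope classical_set_scope.
Local Open Scope ring_scope.

(* The infimum is attained, so it is the minimum over the integers. *)
Definition dist_int (R : realType) (x : R) : R :=
  inf [set `|x - k%:~R| | k in [set: int]].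

(* Only used for 1 <= p <= +oo; the value at p = -oo is a dummy.  The norm of
   'rV[R]_d provided by the library is always the max norm, hence this
   separate function. *)
Definition lpnorm (R : realType) (d : nat) (p : \bar R) (a : 'rV[R]_d) : R :=
  match p with
  | r%:E => (\sum_(i < d) `|a ord0 i| `^ r) `^ r^-1
  | +oo%E => \big[Num.max/0]_(i < d) `|a ord0 i|
  | -oo%E => 0
  end.

Definition affine_form (R : realType) (d : nat) (a : 'rV[R]_d) (b : R)
  (theta : 'rV[R]_d) : R := \sum_(i < d) a ord0 i * theta ord0 i + b.

(* Functions from [1, +oo) to (0, +oo) are represented by total functions on R
   whose values outside [1, +oo) are irrelevant. *)
Definition pos_on_ge1 (R : realType) (f : R -> R) : Prop :=
  forall x, 1 <= x -> 0 < f x.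

Definition nondecreasing_on_ge1 (R : realType) (f : R -> R) : Prop :=
  forall x y, 1 <= x -> x <= y -> f x <= f y.

(* Main.v *)
Require Import Defs.
From mathcomp Require Import all_boot all_order all_algebra.
From mathcomp Require Import all_classical all_reals all_analysis.
From mathcomp Require Import measurable_realfun.
From mathcomp Require Import zify ring lra.
Import Order.TTheory GRing.Theory Num.Theory.
Import numFieldNormedType.Exports.

Set Implicit Arguments.
Unset Strict Implicit.
Unset Printing Implicit Defensive.

Local Open Scope classical_set_scope.
Local Open Scope ring_scope.

(** Put [eta_n = eps / f n] and let [bad n] be the union of the 4-adic cells of
    level [level n] (side about [eta_n / R_n]) meeting [||L_n|| < eta_n].  Inside
    any cell of side at least [1 / R_n], [bad n] has density O([eta_n]).  By the
    growth assumption this applies to the cells of level [level m] as soon as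
    [h m <= n] and [m >= M], where [M] is about [1 / eps]; so removing [bad n] is
    almost independent of the removals up to [m], and the sum of [eta_j] over
    [m < j < n] is O([eps]) by the integral assumption.  A local-lemma induction
    (Peres-Schlag) then shows that the points surviving all removals up to any
    [K] exist, and compactness yields a limit point.  Before the first [m >= M]
    the sum of the [eta_j] is small because the averages of [1 / f] tend to 0.

    To get continuum many points, one base-4 digit of the first coordinate is
    prescribed to be 0 or 2 at a sparse set of times; this costs a factor 4 at
    most once in each window [m < j < n], which the induction tolerates. *)

(** * Counting along the fibres of one coordinate inside blocks of length [T] *)

Section Reblock.
Local Close Scope classical_set_scope.
Local Open Scope nat_scope.
Variables (d N T : nat).
Hypothesis dvdTN : T %| N.
Notation X := {ffun 'I_d -> 'I_N}.

Fact reblock_subproof (v : 'I_N) (t : 'I_T) : v %/ T * T + t < N.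
Proof.
have T0 : 0 < T by case: T t => [[]|].
have lt1 : v %/ T < N %/ T by rewrite ltn_divLR // divnK.
rewrite -[N in _ < N](divnK dvdTN).
apply: (@leq_trans ((v %/ T).+1 * T)); last by rewrite leq_mul2r lt1 orbT.
by rewrite mulSn addnC ltn_add2r.
Qed.

Definition reblock v t : 'I_N := Ordinal (reblock_subproof v t).

Definition upd (i : 'I_d) (x : X) (t : 'I_T) : X :=
  [ffun j => if j == i then reblock (x i) t else x j].

Fact offset_subproof (v : 'I_N) (t : 'I_T) : v %% T < T.
Proof. by apply: ltn_pmod; case: T t => [[]|]. Qed.

Definition swap (i : 'I_d) (p : X * 'I_T) : X * 'I_T :=
  (upd i p.1 p.2, Ordinal (offset_subproof (p.1 i) p.2)).

Lemma upd_eq i x t : upd i x t i = reblock (x i) t.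
Proof. by rewrite ffunE eqxx. Qed.

Lemma swapK i : involutive (swap i).
Proof.
move=> [x t]; rewrite /swap /=.
have T0 : 0 < T by case: (T) t => [[]|].
congr pair; last first.
  by apply/val_inj => /=; rewrite ffunE eqxx /= modnMDl modn_small.
apply/ffunP => j; rewrite !ffunE; case: eqP => [->|//].
apply/val_inj; rewrite /= eqxx /=.
by rewrite divnMDl // (divn_small (ltn_ord t)) addn0 -divn_eq.
Qed.

(** Double counting of pairs [(x, t)]: the involution [swap] exchanges the offset of [x i] in its
    block with [t]. It preserves membership of the first component in [B] and turns the condition on
    [upd i x t] into a condition on [x] alone, so [t] becomes free. *)
Lemma fiber_count (i : 'I_d) (A B : {set X}) :
  (forall x t, (upd i x t \in B) = (x \in B)) ->
  \sum_(x in B) #|[set t | upd i x t \in A]%SET| = (#|A :&: B| * T).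
Proof.
move=> stB.
have sum_pairs (F : X -> 'I_T -> nat) :
    \sum_(p : X * 'I_T | p.1 \in B) F p.1 p.2 = \sum_(x in B) \sum_t F x t.
  by rewrite pair_big_dep /=; apply: eq_bigl => p; rewrite andbT.
transitivity (\sum_(p : X * 'I_T | p.1 \in B) (upd i p.1 p.2 \in A : nat)).
  rewrite (sum_pairs (fun x t => upd i x t \in A : nat)).
  by apply: eq_bigr => x _; rewrite -sum1dep_card big_mkcond.
rewrite (reindex_inj (inv_inj (swapK i))) /=.
transitivity (\sum_(p : X * 'I_T | p.1 \in B) (p.1 \in A : nat)).
  apply: eq_big => [p|p _]; first by rewrite stB.
  by have /= := congr1 fst (swapK i p); rewrite /= => ->.
rewrite (sum_pairs (fun x t => x \in A : nat)).
rewrite -sum1_card big_distrl /= big_mkcond [RHS]big_mkcond /=.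
apply: eq_bigr => x _; rewrite inE.
case: (x \in B); rewrite ?andbT ?andbF //.
by rewrite sum_nat_const card_ord; case: (x \in A); rewrite ?muln1 ?mul1n ?muln0.
Qed.

End Reblock.

(** * The distance to the nearest integer: bounds, Lipschitz property, continuity *)

Section DistInt.
Variable R : realType.
Implicit Types x y e : R.

Lemma dist_int_le x (k : int) : dist_int x <= `|x - k%:~R|.
Proof.
apply: ge_inf; last by exists k.
by exists 0 => _ [j _ <-].
Qed.

Lemma dist_int_ltP x e : dist_int x < e -> exists k : int, `|x - k%:~R| < e.
Proof.
move=> h; have [_ [k _ <-] lt_e] := @inf_lt R _ e
  (ex_intro _ _ (ex_intro2 _ _ 0%Z I erefl)) h.
by exists k.
Qed.

Lemma dist_int_ge x e : (forall k : int, e <= `|x - k%:~R|) -> e <= dist_int x.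
Proof.
move=> h; apply: lb_le_inf; first by exists `|x - 0%Z%:~R|, 0%Z.
by move=> _ [k _ <-].
Qed.

Lemma dist_int_lip x y : dist_int x <= dist_int y + `|x - y|.
Proof.
rewrite -lerBlDr; apply: dist_int_ge => k; rewrite lerBlDr.
apply: le_trans (dist_int_le x k) _.
have -> : x - k%:~R = (y - k%:~R) + (x - y) by rewrite [RHS]addrC subrKA.
exact: ler_normD.
Qed.

Lemma dist_intN x : dist_int (- x) = dist_int x.
Proof.
have le_N y : dist_int (- y) <= dist_int y.
  apply: dist_int_ge => k; apply: le_trans (dist_int_le _ (- k)) _.
  by rewrite rmorphN opprK addrC distrC.
by apply/eqP; rewrite eq_le le_N -{1}(opprK x) le_N.
Qed.

Lemma continuous_dist_int : continuous (@dist_int R).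
Proof.
move=> x; apply/(@cvgrPdist_lt _ R^o) => e e0; near=> y.
have dxy : `|x - y| < e by near: y; exact: (@cvgr_dist_lt _ R^o).
apply: le_lt_trans dxy; rewrite ler_norml.
have := dist_int_lip x y; have := dist_int_lip y x.
by rewrite [`|y - x|]distrC => le1 le2; apply/andP; split; lra.
Unshelve. all: by end_near. Qed.

End DistInt.

(** * Terms of an arithmetic progression that are close to an integer *)

Section Count.
Variables (R : realType) (T : nat).

Lemma card_le_spread (D : nat) (S : {set 'I_T}) :
  (forall s t, s \in S -> t \in S -> (t <= s + D)%N) -> (#|S| <= D.+1)%N.
Proof.
move=> spread; have [->|[s0 s0S]] := set_0Vmem S; first by rewrite cards0.
case: (@arg_minnP _ s0 (fun s => s \in S) (fun s => s : nat) s0S) => m mS min_m.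
rewrite -[leqRHS]card_ord -(@card_in_imset _ _ (fun t : 'I_T => inord (t - m) : 'I_D.+1)).
  exact: max_card.
move=> s t sS tS /(congr1 val); rewrite /= !inordK; last 2 first.
- by have := spread _ _ mS tS; lia.
- by have := spread _ _ mS sS; lia.
move=> e; apply/val_inj => /=.
by have := min_m _ sS; have := min_m _ tS; lia.
Qed.

(** Two terms in a window of length [2 * rho] have indices differing by at most
    [2 * rho / delta]. *)
Lemma card_window (delta gamma rho : R) (S : {set 'I_T}) : 0 < delta -> 0 < rho ->
  (forall t, t \in S -> `|delta * t%:R + gamma| < rho) ->
  #|S|%:R <= 2 * rho / delta + 1.
Proof.
move=> d0 r0 near0; set D := Num.truncn (2 * rho / delta).
have D_le : D%:R <= 2 * rho / delta.
  by rewrite /D truncn_le // divr_ge0 ?mulr_ge0 // ltW.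
suff /card_le_spread h : forall s t, s \in S -> t \in S -> (t <= s + D)%N.
  by apply: (@le_trans _ _ (D.+1%:R)); rewrite ?ler_nat // -natr1 lerD2r.
move=> s t /near0 ns /near0 nt; case: (leqP t s) => [/leq_trans->//|st].
  exact: leq_addr.
rewrite -leq_subLR /D -(@ler_nat R).
move: ns nt; rewrite !ltr_norml => /andP[s1 s2] /andP[t1 t2].
rewrite ler_nat truncn_ge_nat ?divr_ge0 ?mulr_ge0 ?(ltW d0) ?(ltW r0) //.
rewrite ler_pdivlMr // natrB; last exact: ltnW.
by lra.
Qed.

(** The progression has length [delta * T >= 1], so it meets at most
    [delta * T + 3 <= 4 * delta * T] windows around integers. Each window holds at most
    [4 * eta / delta + 1 <= 5 * eta / delta] terms. The product gives the constant 20. *)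
Lemma card_near_int (delta gamma eta : R) (S : {set 'I_T}) :
  0 < `|delta| <= eta -> 4 * eta <= 1 -> 1 <= `|delta| * T%:R ->
  (forall t, t \in S -> dist_int (delta * t%:R + gamma) < 2 * eta) ->
  #|S|%:R <= 20 * eta * T%:R.
Proof.
wlog d0 : delta gamma / 0 < delta.
  move=> wl /andP[d0 de] e4 dT nearS.
  have [dgt|dle] := ltP 0 delta; first by apply: (wl delta gamma); rewrite // d0.
  have dlt : delta < 0 by rewrite lt_neqAle dle andbT -normr_gt0.
  apply: (wl (- delta) (- gamma)); rewrite ?normrN ?d0 ?oppr_gt0 //.
  by move=> t tS; rewrite mulNr -opprD dist_intN; exact: nearS.
rewrite gtr0_norm // d0 /= => de e4 dT nearS.
have e0 : 0 < eta by exact: lt_le_trans de.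
(* Since [4 * eta <= 1], every integer within [2 * eta] of a term lies among [k0, ..., k0 + J]. *)
pose k0 := Num.floor (gamma - 2 * eta).
pose J := Num.truncn (delta * T%:R + 2).
pose W (j : 'I_J.+1) := [set t : 'I_T | `|delta * t%:R + gamma - (k0 + j%:Z)%:~R| < 2 * eta]%SET.
have covS t : t \in S -> exists j : 'I_J.+1, t \in W j.
  move=> /nearS /dist_int_ltP[k hk].
  have /andP[k1 k2] : (k0 <= k)%R && (k <= k0 + J%:Z)%R.
    have t0 : 0 <= delta * t%:R by rewrite mulr_ge0 // ltW.
    have tT : delta * t%:R <= delta * T%:R by rewrite ler_pM2l // ler_nat ltnW.
    have kf := floor_le (gamma - 2 * eta).
    have kl := floorD1_gt (gamma - 2 * eta).
    move: hk; rewrite ltr_norml => /andP[hk1 hk2].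
    rewrite -(ler_int R) -/k0 in kf *.
    apply/andP; split; first by rewrite /k0; lra.
    rewrite -ltzD1 -(ltr_int R) !intrD -/k0 in kl *.
    have := truncnS_gt (delta * T%:R + 2); rewrite -/J -natr1.
    by rewrite -pmulrn; lra.
  have jJ : (`|k - k0| < J.+1)%N by lia.
  exists (Ordinal jJ); rewrite inE /=.
  suff -> : k0 + `|k - k0|%N%:Z = k by [].
  by lia.
have cardS : (#|S| <= \sum_(j < J.+1) #|W j|)%N.
  rewrite -sum1_card (eq_bigr (fun j => \sum_t (t \in W j : nat))%N); last first.
    by move=> j _; rewrite -sum1_card big_mkcond.
  rewrite exchange_big /= big_mkcond leq_sum // => t _.
  by case: ifP => // /covS[j tj]; rewrite (bigD1 j) //= tj.
apply: (@le_trans _ _ (\sum_(j < J.+1) (2 * (2 * eta) / delta + 1))).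
  apply: (@le_trans _ _ (\sum_(j < J.+1) #|W j|)%N%:R); first by rewrite ler_nat.
  rewrite natr_sum; apply: ler_sum => j _.
  apply: (card_window (gamma := gamma - (k0 + j%:Z)%:~R)) => //.
    by rewrite mulr_gt0.
  by move=> t; rewrite inE addrA.
rewrite sumr_const card_ord -[X in X <= _]mulr_natl.
have J_le : J%:R <= delta * T%:R + 2 by rewrite /J truncn_le //; lra.
apply: (@le_trans _ _ ((4 * (delta * T%:R)) * (5 * (eta / delta)))).
  apply: ler_pM => //; first by rewrite addr_ge0 // divr_ge0 // ?mulr_ge0 // ltW.
    by rewrite -natr1; lra.
  have : 1 <= eta / delta by rewrite ler_pdivlMr // mul1r.
  by rewrite [2 * (2 * eta) / _]mulrAC; lra.
by rewrite le_eqVlt; apply/orP; left; apply/eqP; field; rewrite gt_eqF.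
Qed.

End Count.

(** * The 4-adic grid on the unit cube and its cells *)

Section Grid.
Variables (R : realType) (d L : nat).
Notation X := {ffun 'I_d -> 'I_(4 ^ L)}.
Implicit Types (x y : X) (A B : {set X}).

Definition pt x : 'rV[R]_d := \row_i ((x i)%:R / 4 ^+ L).

(** Division by [4 ^ (L - l)] keeps the leading [l] base-4 digits of each coordinate. *)
Definition same_cell l x y : bool :=
  [forall i, (x i %/ 4 ^ (L - l) == y i %/ 4 ^ (L - l))%N].

Definition cell_stable l B : Prop :=
  forall x y, same_cell l x y -> (x \in B) = (y \in B).

Lemma same_cellP l x y :
  reflect (forall i, (x i %/ 4 ^ (L - l) = y i %/ 4 ^ (L - l))%N) (same_cell l x y).
Proof. exact: 'forall_eqP. Qed.

Lemma same_cell_refl l x : same_cell l x x.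
Proof. exact/same_cellP. Qed.

Lemma same_cell_sym l x y : same_cell l x y = same_cell l y x.
Proof. by apply: eq_forallb => i; rewrite eq_sym. Qed.

Lemma same_cell_trans l : transitive (same_cell l).
Proof.
move=> y x z /same_cellP xy /same_cellP yz; apply/same_cellP => i.
by rewrite xy yz.
Qed.

Lemma same_cell_le l l' x y : (l <= l')%N -> same_cell l' x y -> same_cell l x y.
Proof.
move=> ll' /same_cellP xy; apply/same_cellP => i.
rewrite (_ : (L - l = (L - l') + ((L - l) - (L - l')))%N); last by lia.
by rewrite expnD !divnMA xy.
Qed.

Lemma cell_stable_le l l' B : (l <= l')%N -> cell_stable l B -> cell_stable l' B.
Proof. by move=> ll' st x y /(same_cell_le ll') /st. Qed.

Lemma cell_stableI l A B : cell_stable l A -> cell_stable l B -> cell_stable l (A :&: B).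
Proof. by move=> sA sB x y xy; rewrite !inE (sA x y) // (sB x y). Qed.

Lemma cell_stableD l A B : cell_stable l A -> cell_stable l B -> cell_stable l (A :\: B).
Proof. by move=> sA sB x y xy; rewrite !inE (sA x y) // (sB x y). Qed.

Lemma cell_stableT l : cell_stable l [set: X]%SET.
Proof. by move=> x y _; rewrite !inE. Qed.

Fact cell_dvd l : (4 ^ (L - l) %| 4 ^ L)%N.
Proof. by rewrite dvdn_exp2l // leq_subr. Qed.

Lemma same_cell_upd l i x t : same_cell l (upd (cell_dvd l) i x t) x.
Proof.
apply/same_cellP => j; rewrite ffunE; case: eqP => // ->.
by rewrite /= divnMDl ?expn_gt0 // (divn_small (ltn_ord t)) addn0.
Qed.

Lemma pow4_gt0 n : 0 < 4 ^+ n :> R.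
Proof. by rewrite exprn_gt0. Qed.

Lemma same_cell_pt l x y i : (l <= L)%N -> same_cell l x y ->
  `|pt x ord0 i - pt y ord0 i| <= (4 ^+ l)^-1.
Proof.
move=> lL /same_cellP /(_ i) e; rewrite !mxE -mulrBl normrM.
rewrite (@ger0_norm _ (_^-1)) ?invr_ge0 ?exprn_ge0 //.
rewrite ler_pdivrMr ?pow4_gt0 // -[in leRHS](subnKC lL) exprD mulKf ?gt_eqF ?pow4_gt0 //.
rewrite (divn_eq (x i) (4 ^ (L - l))) (divn_eq (y i) (4 ^ (L - l))) e.
set q := (_ %/ _ * _)%N.
have := ltn_pmod (x i) (expn_gt0 4 (L - l) : (0 < 4 ^ (L - l))%N).
have := ltn_pmod (y i) (expn_gt0 4 (L - l) : (0 < 4 ^ (L - l))%N).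
set u := (_ %% _)%N; set v := (_ %% _)%N; rewrite -(ltr_nat R) -[(v < _)%N](ltr_nat R).
rewrite natrX !natrD => u_lt v_lt.
have := ler0n R u; have := ler0n R v.
by rewrite ler_norml => ? ?; apply/andP; split; lra.
Qed.

(** * Density of the cells on which an affine form comes close to an integer *)

Section Near.
Variables (a : 'rV[R]_d) (b eta rho : R) (l : nat).
Hypothesis lL : (l <= L)%N.
Hypothesis a_le : forall i, `|a ord0 i| <= rho.
Hypothesis l_ge : d%:R * rho <= eta * 4 ^+ l.

(* Saturated under [same_cell], hence a union of cells of level [l]. *)
Definition near_set : {set X} :=
  [set x | [exists y, same_cell l x y && (dist_int (affine_form a b (pt y)) < eta)]]%SET.

Lemma near_set_stable : cell_stable l near_set.
Proof.
move=> x y xy; rewrite !inE; apply: eq_existsb => z; congr andb.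
apply/idP/idP; first by apply: same_cell_trans; rewrite same_cell_sym.
exact: same_cell_trans.
Qed.

Lemma notin_near_set x :
  x \notin near_set -> eta <= dist_int (affine_form a b (pt x)).
Proof.
rewrite inE negb_exists => /forallP /(_ x).
by rewrite same_cell_refl /= -leNgt.
Qed.

(** Saturation under [same_cell] costs only a factor 2: by [l_ge], the form varies by at most [eta]
    on a cell of level [l]. *)
Lemma in_near_set x :
  x \in near_set -> dist_int (affine_form a b (pt x)) < 2 * eta.
Proof.
rewrite inE => /existsP[y /andP[xy dy]].
apply: le_lt_trans (dist_int_lip _ (affine_form a b (pt y))) _.
rewrite mulr_natl mulr2n; apply: ltr_leD => //.
rewrite /affine_form opprD addrACA subrr addr0 -sumrB.
apply: le_trans (ler_norm_sum _ _ _) _.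
apply: (@le_trans _ _ (\sum_(i < d) rho * (4 ^+ l)^-1)); last first.
  rewrite sumr_const card_ord -[X in X <= _]mulr_natl mulrA.
  by rewrite ler_pdivrMr ?pow4_gt0.
apply: ler_sum => i _; rewrite -mulrBr normrM.
by apply: ler_pM => //; exact: same_cell_pt.
Qed.

(** Along a fibre the form is an arithmetic progression in [t] with step [a_i / 4 ^ L], the shape
    required by [card_near_int]. *)
Lemma affine_form_upd l' i x t :
  affine_form a b (pt (upd (cell_dvd l') i x t)) =
  a ord0 i / 4 ^+ L * t%:R + (a ord0 i / 4 ^+ L * (x i %/ 4 ^ (L - l') * 4 ^ (L - l'))%N%:R
    + \sum_(j < d | j != i) a ord0 j * pt x ord0 j + b).
Proof.
rewrite /affine_form (bigD1 i) //= mxE upd_eq /=.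
rewrite (eq_bigr (fun j => a ord0 j * pt x ord0 j)); last first.
  by move=> j ji; rewrite !mxE ffunE (negbTE ji).
by rewrite natrD; ring.
Qed.

(** A fibre in direction [i] inside a cell of level [l'] stays in [B], and along it the form runs
    over a length [|a_i| / 4 ^ l' >= 1] in steps of size at most [eta]. So [card_near_int] bounds
    each fibre and [fiber_count] adds up the bounds. *)
Lemma card_near_set l' i B : (l' <= L)%N -> cell_stable l' B ->
  4 * eta <= 1 -> 4 ^+ l' <= `|a ord0 i| ->
  #|near_set :&: B|%:R <= 20 * eta * #|B|%:R :> R.
Proof.
move=> l'L stB eta4 a_ge.
have d1 : 1 <= d%:R :> R by rewrite ler1n (leq_ltn_trans _ (ltn_ord i)).
have a0 : 0 < `|a ord0 i| by apply: lt_le_trans a_ge; exact: pow4_gt0.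
have /(congr1 (fun n : nat => n%:R : R)) := @fiber_count _ _ _ (cell_dvd l') i near_set _
  (fun x t => stB _ _ (same_cell_upd i x t)).
have T0 : 0 < (4 ^ (L - l'))%N%:R :> R by rewrite ltr0n expn_gt0.
rewrite natr_sum natrM => e.
rewrite -(ler_pM2r T0) -e.
rewrite mulrAC mulr_natr -sumr_const; apply: ler_sum => x xB.
apply: (card_near_int (delta := a ord0 i / 4 ^+ L)) => //.
- rewrite normrM normfV (@ger0_norm _ (4 ^+ L)) ?exprn_ge0 //.
  rewrite divr_gt0 ?pow4_gt0 //= ler_pdivrMr ?pow4_gt0 //.
  apply: (le_trans (a_le i)); apply: (@le_trans _ _ (d%:R * rho)).
    by rewrite ler_peMl //; apply: le_trans (a_le i).
  have e0 : 0 <= eta.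
    rewrite -(pmulr_lge0 _ (pow4_gt0 l)); apply: le_trans l_ge.
    by rewrite mulr_ge0 //; apply: le_trans (a_le i).
  by apply: le_trans l_ge _; rewrite ler_wpM2l // ler_weXn2l // ler1n.
- rewrite normrM normfV (@ger0_norm _ (4 ^+ L)) ?exprn_ge0 //.
  rewrite natrX mulrAC ler_pdivlMr ?pow4_gt0 // mul1r -[in leLHS](subnKC l'L) exprD.
  by rewrite ler_pM2r ?pow4_gt0.
- by move=> t; rewrite inE => /in_near_set; rewrite affine_form_upd; apply.
Qed.

End Near.

(** * Prescribing one base-4 digit *)

Section Digit.
Variables (l : nat) (i : 'I_d) (beta : bool).
Hypothesis lL : (l < L)%N.

(* Only the digits 0 and 2 are used: the closures of the two sets of points
   are then disjoint, so that different choices survive a passage to the limit. *)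
Definition digit_set : {set X} :=
  [set x : X | ((x i %/ 4 ^ (L - l.+1)) %% 4 == 2 * beta)%N]%SET.

Lemma digit_set_stable : cell_stable l.+1 digit_set.
Proof. by move=> x y /same_cellP /(_ i) e; rewrite !inE e. Qed.

(** On each fibre inside a cell of level [l], at least [T'] of the [4 * T'] offsets give the next
    digit its prescribed value. *)
Lemma card_digit_set B : cell_stable l B -> (#|B| <= 4 * #|digit_set :&: B|)%N.
Proof.
move=> stB; have := @fiber_count _ _ _ (cell_dvd l) i digit_set _
  (fun x t => stB _ _ (same_cell_upd i x t)).
set T' := (4 ^ (L - l.+1))%N.
have T'0 : (0 < T')%N by rewrite expn_gt0.
have TE : (4 ^ (L - l) = 4 * T')%N by rewrite -expnS; congr (_ ^ _)%N; lia.
move=> e; suff : (#|B| * T' <= #|digit_set :&: B| * 4 ^ (L - l))%N.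
  by rewrite TE mulnA leq_pmul2r // mulnC.
rewrite -e -sum_nat_const; apply: leq_sum => x xB.
have lt1 (s : 'I_T') : (2 * beta * T' + s < 4 ^ (L - l))%N.
  rewrite TE; have := ltn_ord s; case: beta => /=; lia.
rewrite -[leqLHS]card_ord -(@card_imset _ _ (fun s => Ordinal (lt1 s))); last first.
  by move=> s t /(congr1 val) /= /addnI /val_inj.
apply: subset_leq_card; apply/fintype.subsetP => t /imsetP[s _ ->].
rewrite !inE upd_eq /= TE -/T' mulnA divnMDl // divnMDl // (divn_small (ltn_ord s)) addn0.
rewrite addnC -modnDmr modnMl addn0 modn_small //.
by case: beta.
Qed.

(** The digit [2 * beta] puts the fractional part of [4 ^ l * x_i] into the quarter interval centred
    at [beta / 2 + 1 / 8]. This form of the condition is closed, hence stable under limits. *)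
Lemma in_digit_set x : x \in digit_set ->
  dist_int (4 ^+ l * pt x ord0 i - beta%:R / 2 - 8^-1) <= 8^-1 :> R.
Proof.
rewrite inE => /eqP e; set T' := (4 ^ (L - l.+1))%N in e.
have T'0 : (0 < T')%N by rewrite expn_gt0.
apply: (le_trans (dist_int_le _ ((x i %/ T' %/ 4)%N%:Z))).
have LE : 4 ^+ L = 4 ^+ l * (4 * T'%:R) :> R.
  by rewrite natrX -exprS -exprD; congr (_ ^+ _); lia.
rewrite mxE LE invfM mulrCA mulVKf ?gt_eqF ?pow4_gt0 //.
rewrite [in (x i)%:R](divn_eq (x i) T') [in (x i %/ T' * _)%N](divn_eq (x i %/ T')%N 4) e.
have := ltn_pmod (x i) T'0; rewrite -(ltr_nat R).
set r := (_ %% _)%N; set q := (_ %/ _)%N; move=> r_lt.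
have T'R : 0 < T'%:R :> R by rewrite ltr0n.
have -> : ((q * 4 + 2 * beta) * T' + r)%N%:R / (4 * T'%:R)
   - beta%:R / 2 - 8^-1 - q%:~R = r%:R / T'%:R / 4 - 8^-1 :> R.
  by rewrite -pmulrn !natrD !natrM !natrD !natrM; field; rewrite gt_eqF.
have h1 : 0 <= r%:R / T'%:R :> R by rewrite divr_ge0.
have h2 : r%:R / T'%:R <= 1 :> R by rewrite ler_pdivrMr // mul1r ltW.
by rewrite ler_norml; apply/andP; split; lra.
Qed.

End Digit.
End Grid.

(** * The local-lemma induction on the number of surviving points *)

Section Survival.
Variable R : realType.
Implicit Types (u c e w y : nat -> R).

Lemma prod_telescope_le u c m k : (m <= k)%N -> (forall j, 0 <= c j) ->
  (forall j, (j < k)%N -> c j * u j <= u j.+1) ->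
  (\prod_(m <= j < k) c j) * u m <= u k.
Proof.
move=> mk c0; elim: k mk => [|k IH].
  by rewrite leqn0 => /eqP->; rewrite big_geq // mul1r.
rewrite leq_eqVlt => /predU1P[->|mk] step; first by rewrite big_geq // mul1r.
rewrite big_nat_recr //= -mulrA mulrCA.
apply: le_trans (step k (ltnSn k)); rewrite ler_wpM2l //.
by apply: IH => // j jk; apply: step; exact: ltnW.
Qed.

(** The Weierstrass product inequality. *)
Lemma prod_1B_ge y m k : (forall j, 0 <= y j <= 1) ->
  1 - \sum_(m <= j < k) y j <= \prod_(m <= j < k) (1 - y j) <= 1.
Proof.
move=> y01; elim: k => [|k /andP[ge1 le1]].
  by rewrite !big_geq // subr0 lexx.
case: (leqP m k) => mk; last by rewrite !big_geq // subr0 lexx.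
have /andP[y0 y1] := y01 k; rewrite !big_nat_recr //=.
have P0 : 0 <= \prod_(m <= j < k) (1 - y j).
  by apply: prodr_ge0 => j _; have := y01 j; lra.
by apply/andP; split; nra.
Qed.

(* The usual local-lemma induction: [(1 - 8 e j)] bounds the relative loss at
   step [j], and the steps between [m k] and [k] lose at most a factor 8. *)
Lemma survival u e w (m : nat -> nat) (K : nat) :
  0 < u 0%N -> (forall k, 0 <= e k) -> (forall k, 0 < w k) ->
  (forall k, (m k <= k)%N) -> (forall k, 16 * e k <= 1) ->
  (forall k, (k < K)%N -> w k * (u k - e k * u (m k)) <= u k.+1) ->
  (forall k, 16 * \sum_(m k <= j < k) e j <= 1) ->
  (forall k, 1 <= 4 * \prod_(m k <= j < k) w j) ->
  0 < u K.
Proof.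
move=> u0 e0 w0 mk e16 step sum_e prod_w.
pose c j := w j * (1 - 8 * e j).
have c_gt0 j : 0 < c j by rewrite mulr_gt0 //; have := e16 j; have := e0 j; lra.
suff P k : (k <= K)%N -> 0 < u k /\ forall j, (j < k)%N -> c j * u j <= u j.+1.
  by have [] := P K (leqnn K).
elim: k => [|k IHk kK]; first by [].
have [uk IH] := IHk (ltnW kK).
have stepk : c k * u k <= u k.+1; last first.
  split; first by apply: lt_le_trans stepk; rewrite mulr_gt0.
  by move=> j; rewrite ltnS leq_eqVlt => /predU1P[->//|/IH].
apply: le_trans (step k kK); rewrite /c -mulrA ler_wpM2l ?(ltW (w0 k)) //.
have tele := prod_telescope_le (mk k) (fun j => ltW (c_gt0 j)) IH.
rewrite big_split /= in tele.
have y01 j : 0 <= 8 * e j <= 1 by have := e16 j; have := e0 j; lra.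
have /andP[ge1 le1] := prod_1B_ge (m k) k y01.
rewrite -mulr_sumr in ge1.
have := sum_e k; have := prod_w k.
move: ge1 le1 tele; set Q := \prod_(_ <= _ < _) (1 - _); set W := \prod_(_ <= _ < _) w _.
set S := \sum_(_ <= _ < _) _ => ge1 le1 tele W4 S16.
(* Here [W >= 1 / 4], and [Q >= 1 - 8 * S >= 1 / 2]. *)
have WQ : 1 <= 8 * (W * Q) by nra.
have um : u (m k) <= 8 * u k.
  case: (leP (u (m k)) 0) => [?|um0]; first by lra.
  apply: le_trans (_ : 8 * (W * Q * u (m k)) <= _); last by rewrite ler_wpM2l.
  by rewrite mulrA ler_peMl // ltW.
have := ler_wpM2l (e0 k) um; lra.
Qed.

End Survival.

(** A cluster point of [v] in the compact cube lies in each closed [P n], since [P n] contains the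
    tail of [v] from [n] on. *)
Lemma cube_limit (R : realType) d (v : nat -> 'rV[R]_d) (P : nat -> set 'rV[R]_d) :
  (forall K i, 0 <= v K ord0 i <= 1) -> (forall n, closed (P n)) ->
  (forall n K, (n <= K)%N -> P n (v K)) ->
  exists2 w : 'rV[R]_d, (forall i, 0 <= w ord0 i <= 1) & forall n, P n w.
Proof.
move=> v01 clP vPn.
have [|w [w01 wcl]] := @rV_compact R d (fun=> `[0, 1]%classic)
    (fun i => @segment_compact R 0 1) (v @ \oo) _.
  by exists 0%N => // K _ i; rewrite /= in_itv /= v01.
exists w => [i|n]; first by have := w01 i; rewrite /= in_itv.
apply: clP => B /wcl; apply.
by exists n => // K /= nK; exact: vPn.
Qed.

Lemma continuous_affine_form (R : realType) d (u : 'rV[R]_d) (e : R) : continuous (affine_form u e).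
Proof.
have sc : continuous (fun v : 'rV[R]_d => \sum_(i < d) u ord0 i * v ord0 i).
  apply: continuous_big => [|i _ v]; first exact: add_continuous.
  by apply: (@cvgM _ _ (nbhs v)); [exact: cvg_cst|exact: coord_continuous].
by move=> v; apply: (@cvgD _ _ _ (nbhs v)); [exact: sc|exact: cvg_cst].
Qed.

(** * The removal process in the unit cube: [F] stands for [1 / f], [r] for the norms, [H] for the
    integer part of [h] *)

Section FiniteStage.
Variables (R : realType) (d : nat) (i0 : 'I_d).
Variables (a : nat -> 'rV[R]_d) (b F r : nat -> R) (H : nat -> nat).
Variables (c C eps : R) (M : nat).
Hypothesis F_gt0 : forall n, (0 < n)%N -> 0 < F n.
Hypothesis F_noninc : forall n m, (0 < n <= m)%N -> F m <= F n.
Hypothesis sum_F : forall n k, (0 < n)%N -> (k <= H n)%N ->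
  \sum_(n <= j < k) F j <= C.
Hypothesis F1_le : F 1%N <= C.
Hypothesis r_ndecr : forall n m, (0 < n <= m)%N -> r n <= r m.
Hypothesis r1_ge : d%:R <= r 1%N.
Hypothesis a_le : forall n, (0 < n)%N -> forall i, `|a n ord0 i| <= r n.
Hypothesis a_ge : forall n, (0 < n)%N -> exists i, r n <= d%:R * `|a n ord0 i|.
Hypothesis H_ge : forall n, (0 < n)%N -> (n <= H n)%N.
Hypothesis c_gt0 : 0 < c.
Hypothesis growth : forall n, (M <= n)%N -> c * n%:R * r n <= r (H n) * F n.
Hypothesis M_gt0 : (0 < M)%N.
Hypothesis eps_gt0 : 0 < eps.
Hypothesis M_large : 16 * d%:R ^+ 2 <= c * M%:R * eps.
Hypothesis eps_small : 320 * (eps * (\sum_(1 <= j < M) F j + C)) <= 1.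

(* On a cell of side [4 ^- l] with [scale n <= 4 ^+ l], [L_n] varies by at most
   [eps * F n]. *)
Definition scale n : R := d%:R * r n / (eps * F n).

Fact level_subproof n : exists l, scale n <= 4 ^+ l.
Proof.
exists (Num.truncn (scale n)).+1.
apply: le_trans (ltW (truncnS_gt _)) _.
by rewrite -natrX ler_nat; apply: ltnW; exact: ltn_expl.
Qed.

Definition level n : nat := ex_minn (level_subproof n).

Lemma level_ge n : scale n <= 4 ^+ level n.
Proof. by rewrite /level; case: ex_minnP. Qed.

Lemma level_min n l : scale n <= 4 ^+ l -> (level n <= l)%N.
Proof. by rewrite /level; case: ex_minnP => ? _ h /h. Qed.

Let d_ge1 : 1 <= d%:R :> R.
Proof. by rewrite ler1n (leq_ltn_trans _ (ltn_ord i0)). Qed.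

Let sumF_ge0 : 0 <= \sum_(1 <= j < M) F j.
Proof. by rewrite big_nat; apply: sumr_ge0 => j /andP[/F_gt0/ltW]. Qed.

Let r_ge n : (0 < n)%N -> d%:R <= r n.
Proof. by move=> n0; apply: le_trans r1_ge _; exact: r_ndecr. Qed.

Let F_le n : (0 < n)%N -> F n <= C.
Proof. by move=> n0; apply: le_trans F1_le; exact: F_noninc. Qed.

Let epsF_le n : (0 < n)%N -> 320 * (eps * F n) <= 1.
Proof.
move=> n0; apply: le_trans eps_small; rewrite ler_pM2l // ler_pM2l //.
by have := F_le n0; have := sumF_ge0; lra.
Qed.

Let epsF_gt0 n : (0 < n)%N -> 0 < eps * F n.
Proof. by move=> n0; rewrite mulr_gt0 // F_gt0. Qed.

Lemma scale_ge n : (0 < n)%N -> r n <= scale n.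
Proof.
move=> n0; rewrite ler_pdivlMr ?epsF_gt0 //.
rewrite mulrC ler_wpM2r ?(le_trans _ (r_ge n0)) //.
by have := epsF_le n0; have := d_ge1; lra.
Qed.

Lemma scale_ndecr n m : (0 < n <= m)%N -> scale n <= scale m.
Proof.
move=> /andP[n0 nm]; have m0 : (0 < m)%N by exact: leq_trans nm.
have rn0 : 0 <= r n by apply: le_trans (r_ge n0).
apply: ler_pM.
- by rewrite mulr_ge0.
- by rewrite invr_ge0 ltW ?epsF_gt0.
- by rewrite ler_wpM2l // r_ndecr ?n0.
- by rewrite lef_pV2 ?posrE ?epsF_gt0 // ler_wpM2l ?F_noninc ?n0 // ltW.
Qed.

Lemma level_ndecr n m : (0 < n <= m)%N -> (level n <= level m)%N.
Proof. by move=> nm; apply: level_min; apply: le_trans (scale_ndecr nm) (level_ge m). Qed.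

Lemma level_lt n : (0 < n)%N -> 4 ^+ level n <= 4 * scale n.
Proof.
(* Minimality of [level n] says nothing when it is 0; that case needs [scale n >= 1]. *)
move=> n0; have scale1 : 1 <= scale n.
  by apply: le_trans (scale_ge n0); apply: le_trans (r_ge n0).
case E : (level n) => [|l]; first by rewrite expr0; lra.
rewrite exprS ler_pM2l // leNgt; apply/negP => /ltW /level_min.
by rewrite E ltnn.
Qed.

(** The growth assumption enters here. The left side is at most [16 * d ^ 2 * r j / (eps * F j)]; by
    [M_large] and [growth] this is at most [r (H j)]. The successor leaves room for a digit
    prescribed just below [level j]. *)
Lemma pow_level_le j n : (M <= j)%N -> (H j <= n)%N -> d%:R * 4 ^+ (level j).+1 <= r n.
Proof.
move=> Mj Hn; have j0 : (0 < j)%N by exact: leq_trans Mj.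
have n0 : (0 < H j)%N by apply: leq_trans (H_ge j0).
apply: (@le_trans _ _ (r (H j))); last by rewrite r_ndecr // n0.
rewrite exprS; apply: (@le_trans _ _ (d%:R * (4 * (4 * scale j)))).
  by rewrite ler_wpM2l // ler_wpM2l // level_lt.
rewrite /scale (_ : _ * _ = (16 * d%:R ^+ 2 * r j) / (eps * F j)); last by ring.
rewrite ler_pdivrMr ?epsF_gt0 // [leRHS]mulrCA.
apply: (@le_trans _ _ (c * M%:R * eps * r j)).
  by rewrite ler_wpM2r // (le_trans _ (r_ge j0)).
apply: (@le_trans _ _ (eps * (c * j%:R * r j))).
  have -> : c * M%:R * eps * r j = c * eps * r j * M%:R by ring.
  have -> : eps * (c * j%:R * r j) = c * eps * r j * j%:R by ring.
  rewrite ler_wpM2l ?ler_nat // mulr_ge0 ?(le_trans _ (r_ge j0)) //.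
  by rewrite mulr_ge0 // ltW.
by rewrite ler_pM2l // growth.
Qed.

(* The last time whose cells are coarse enough for [L_n] to equidistribute on
   them; 0 (the whole cube) if there is none. *)
Definition past n : nat := \max_(m < n | (M <= m)%N && (H m <= n)%N) m.

Lemma past_lt n : (0 < n)%N -> (past n < n)%N.
Proof.
case: n => // n _; rewrite ltnS; apply/bigmax_leqP => m _.
by rewrite -ltnS.
Qed.

Lemma le_past m n : (M <= m < n)%N -> (H m <= n)%N -> (m <= past n)%N.
Proof.
move=> /andP[Mm mn] Hm.
by apply: (@leq_bigmax_cond _ _ (fun m : 'I_n => m : nat) (Ordinal mn)); rewrite Mm.
Qed.

Lemma pastP n : past n = 0%N \/ [/\ (M <= past n)%N & (H (past n) <= n)%N].
Proof.
rewrite /past; have [p0|] := posnP #|[pred m : 'I_n | (M <= m)%N && (H m <= n)%N]|.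
  by left; rewrite big_pred0 // => m; have := card0_eq p0 m; rewrite inE.
by move=> /(eq_bigmax_cond (fun m : 'I_n => m : nat))[m /andP[? ?] ->]; right.
Qed.

(** By maximality of [past n], a window that starts at some [m >= M] ends no later than [H m], so
    [sum_F] applies. If [past n = 0], the indices below [M] give the first sum and those from [M] on
    give at most [C]. *)
Lemma sum_F_past n : (0 < n)%N ->
  \sum_((past n).+1 <= j < n) F j <= \sum_(1 <= j < M) F j + C.
Proof.
move=> n0; have C0 : 0 <= C by apply: le_trans (F_le n0); exact/ltW/F_gt0.
have [past0|[Mp Hp]] := pastP n.
  rewrite past0; have [nM|Mn] := leqP n M.
    rewrite (big_cat_nat _ nM) //= -addrA lerDl addr_ge0 //.
    rewrite big_nat; apply: sumr_ge0 => j /andP[nj _].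
    by apply/ltW/F_gt0/(leq_trans n0).
  rewrite (big_cat_nat _ (ltnW Mn)) //= lerD2l sum_F //.
  rewrite leqNgt; apply/negP => HM.
  have := @le_past M n; rewrite leqnn Mn past0 leqn0.
  by move=> /(_ isT (ltnW HM)); rewrite -leqn0 leqNgt M_gt0.
have [lt_n|ge_n] := ltnP (past n).+1 n; last first.
  by rewrite big_geq // addr_ge0.
suff h : (n <= H (past n).+1)%N.
  by have := sum_F (ltn0Sn (past n)) h; have := sumF_ge0; lra.
rewrite leqNgt; apply/negP => /ltnW /(le_past (m := (past n).+1)).
by rewrite lt_n (leq_trans Mp) // ltnn => /(_ isT).
Qed.

Variables (T : pred nat) (beta : nat -> bool).
Hypothesis T_ge : forall n, T n -> (M <= n)%N.
Hypothesis T_sparse : forall j k, T j -> T k -> (j < k)%N -> (H j < k)%N.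

Definition weight n : R := if T n then 4^-1 else 1.

(** At most one marked time lies strictly between [past n] and [n]: for two of them, [j < k],
    sparsity gives [H j < k < n], hence [j <= past n]. *)
Lemma prod_weight_past n : 1 <= 4 * \prod_((past n).+1 <= j < n) weight j.
Proof.
have uniqT j k : (past n < j)%N -> T j -> T k -> (j < k < n)%N -> False.
  move=> pj Tj Tk /andP[jk kn]; have := T_sparse Tj Tk jk => Hj.
  have := @le_past j n; rewrite (T_ge Tj) (ltn_trans jk kn).
  by move=> /(_ isT (ltnW (ltn_trans Hj kn))); rewrite leqNgt pj.
suff P k : (k <= n)%N -> 1 <= 4 * \prod_((past n).+1 <= j < k) weight j by exact: P.
elim: k => [|k IH kn]; first by rewrite big_geq // mulr1 ler1n.
have [km|mk] := leqP k (past n); first by rewrite big_geq ?mulr1 ?ler1n.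
rewrite big_nat_recr //=; case Tk: (T k); last by rewrite /weight Tk mulr1 IH // ltnW.
rewrite big_nat big1 => [|j /andP[pj jk]]; first by rewrite /weight Tk; lra.
rewrite /weight; case Tj: (T j) => //.
by case: (uniqT j k); rewrite ?jk.
Qed.

(** * The removal process on a grid finer than all levels up to [K] *)

Section FixedGrid.
Variables (K L : nat).
Hypothesis level_ltL : forall n, (n <= K)%N -> (level n < L)%N.
Notation X := {ffun 'I_d -> 'I_(4 ^ L)}.

Definition bad n : {set X} := near_set L (a n) (b n) (eps * F n) (level n).

Fixpoint good n : {set X} :=
  if n is k.+1 then
    let G := (good k :\: bad n)%SET in
    if T n then (digit_set L (level n) i0 (beta n) :&: G)%SET else G
  else [set: X]%SET.

(** The summand [T j], read as 0 or 1, accounts for the extra digit fixed below [level j] at a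
    marked time. *)
Lemma good_stable k q : (k <= K)%N ->
  (forall j, (0 < j <= k)%N -> (level j + T j <= q)%N) -> cell_stable q (good k).
Proof.
elim: k => [|k IH] kK lq /=; first exact: cell_stableT.
have lk := lq k.+1 (leqnn _).
have stG : cell_stable q (good k :\: bad k.+1)%SET.
  apply: cell_stableD.
    by apply: IH => [|j /andP[j0 jk]]; [exact: ltnW|apply: lq; rewrite j0 leqW].
  apply: (@cell_stable_le _ _ (level k.+1)); last exact: near_set_stable.
  by apply: leq_trans lk; exact: leq_addr.
case: ifP => // Tk; apply: cell_stableI => //.
apply: (@cell_stable_le _ _ (level k.+1).+1); last exact: digit_set_stable.
by move: lk; rewrite Tk addn1.
Qed.

Lemma good_sub m k : (m <= k)%N -> good k \subset good m.
Proof.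
elim: k => [|k IH]; first by rewrite leqn0 => /eqP->.
rewrite leq_eqVlt => /predU1P[->//|/IH sub]; apply: fintype.subset_trans sub => /=.
have subD : (good k :\: bad k.+1)%SET \subset good k by exact: finset.subsetDl.
by case: ifP => // _; apply: fintype.subset_trans subD; exact: finset.subsetIr.
Qed.

Lemma card_bad_past n : (0 < n <= K)%N ->
  #|bad n :&: good (past n)|%:R <= 20 * (eps * F n) * #|good (past n)|%:R :> R.
Proof.
move=> /andP[n0 nK]; have [i ai] := a_ge n0.
have pastK : (past n <= K)%N by apply: leq_trans nK; exact/ltnW/past_lt.
(* A level [q] coarse enough for the form [n] to oscillate: the whole cube if [past n = 0],
   otherwise one digit below the level of [past n]. *)
have [q [qL stq qa]] : exists q, [/\ (q <= L)%N, cell_stable q (good (past n)) &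
    d%:R * 4 ^+ q <= r n].
  have [p0|[Mp Hp]] := pastP n.
    exists 0%N; split => //; first by rewrite p0; exact: cell_stableT.
    by rewrite expr0 mulr1 r_ge.
  exists (level (past n)).+1; split; last exact: pow_level_le.
    exact: level_ltL.
  apply: good_stable => // j jp; rewrite -addn1; apply: leq_add (leq_b1 _).
  exact: level_ndecr.
apply: (@card_near_set _ _ _ _ _ _ (r n) _ _ (a_le n0) _ q i) => //.
- exact/ltnW/level_ltL.
- by rewrite [leRHS]mulrC -ler_pdivrMr ?epsF_gt0 // level_ge.
- by have := epsF_le n0; have := epsF_gt0 n0; lra.
- have d0 : 0 < d%:R :> R by exact: lt_le_trans d_ge1.
  by rewrite -(ler_pM2l d0); exact: le_trans ai.
Qed.

(** Points of [good k] lost to [bad n] also lie in the larger set [good (past n)], where the density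
    of [bad n] is known. A prescribed digit then keeps at least a quarter of the rest. *)
Lemma card_good_step k : (k < K)%N ->
  weight k.+1 * (#|good k|%:R - 20 * (eps * F k.+1) * #|good (past k.+1)|%:R)
    <= #|good k.+1|%:R :> R.
Proof.
move=> kK; set n := k.+1; have n0 : (0 < n)%N by [].
set G := (good k :\: bad n)%SET.
have cardG : #|good k|%:R - 20 * (eps * F n) * #|good (past n)|%:R <= #|G|%:R :> R.
  rewrite lerBlDr -(cardsID (bad n) (good k)) natrD addrC lerD2l.
  apply: le_trans (card_bad_past _); rewrite ?n0 // ler_nat.
  rewrite finset.setIC subset_leq_card // finset.setIS //.
  by apply: good_sub; rewrite -ltnS past_lt.
rewrite /weight /= -/n -/G; case: ifP => Tn; last by rewrite mul1r.
(* Digits prescribed earlier must not reach below [level n]: an earlier marked [j] has [H j <= n],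
   so [4 ^ (level j + 1) <= r n <= scale n]. *)
have stG : cell_stable (level n) G.
  apply: cell_stableD; last exact: near_set_stable.
  apply: good_stable => [|j /andP[j0 jk]]; first exact: ltnW.
  case Tj: (T j); last by rewrite addn0 level_ndecr // j0 leqW.
  rewrite addn1 -(@ler_eXn2l R 4) ?ltr1n //; apply: le_trans (level_ge n).
  apply: le_trans (scale_ge n0).
  have Hj : (H j <= n)%N by apply/ltnW/T_sparse.
  apply: le_trans (pow_level_le (T_ge Tj) Hj).
  by rewrite ler_peMl // exprn_ge0.
have := card_digit_set i0 (beta n) (level_ltL kK) stG.
rewrite -(ler_nat R) natrM; lra.
Qed.

Lemma good_neq0 : good K != finset.set0.
Proof.
rewrite -card_gt0 -(ltr0n R).
(* Step [k] removes [bad k.+1], whence the shifted indices; the 320 in [eps_small] is 16 times the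
   density constant 20. *)
apply: (@survival _ (fun k => #|good k|%:R) (fun k => 20 * (eps * F k.+1))
  (fun k => weight k.+1) (fun k => past k.+1)).
- rewrite ltr0n /= cardsT; apply/card_gt0P.
  have p : (0 < 4 ^ L)%N by rewrite expn_gt0.
  by exists [ffun=> Ordinal p].
- by move=> k; rewrite mulr_ge0 // ltW ?epsF_gt0.
- by move=> k; rewrite /weight; case: ifP => _; rewrite ?invr_gt0.
- by move=> k; rewrite -ltnS past_lt.
- by move=> k; have := epsF_le (ltn0Sn k); lra.
- exact: card_good_step.
- move=> k; rewrite -mulr_sumr -mulr_sumr.
  have <- : \sum_((past k.+1).+1 <= j < k.+1) F j = \sum_(past k.+1 <= j < k) F j.+1.
    by rewrite big_add1.
  have := ler_wpM2l (ltW eps_gt0) (sum_F_past (ltn0Sn k)).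
  move: eps_small; lra.
- by move=> k; have := prod_weight_past k.+1; rewrite big_add1.
Qed.

Lemma in_goodP n x : (0 < n <= K)%N -> x \in good K ->
  eps * F n <= dist_int (affine_form (a n) (b n) (pt R x)) /\
  (T n -> dist_int (4 ^+ level n * pt R x ord0 i0 - (beta n)%:R / 2 - 8^-1) <= 8^-1 :> R).
Proof.
case: n => // n nK /(fintype.subsetP (good_sub nK)) /=.
case: ifP => Tn; last first.
  by rewrite finset.in_setD => /andP[/notin_near_set].
rewrite finset.in_setI finset.in_setD => /andP[xd /andP[/notin_near_set xb _]]; split => // _.
by apply: in_digit_set => //; exact: level_ltL.
Qed.

End FixedGrid.

Definition avoids n (v : 'rV[R]_d) : Prop :=
  eps * F n <= dist_int (affine_form (a n) (b n) v) /\
  (T n -> dist_int (4 ^+ level n * v ord0 i0 - (beta n)%:R / 2 - 8^-1) <= 8^-1 :> R).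

Lemma exists_avoids_upto K : exists v : 'rV[R]_d,
  (forall i, 0 <= v ord0 i <= 1) /\ forall n, (0 < n <= K)%N -> avoids n v.
Proof.
pose L := (\max_(n < K.+1) level n).+1.
have level_ltL n : (n <= K)%N -> (level n < L)%N.
  rewrite -ltnS => nK.
  exact: (leq_bigmax (F := fun n : 'I_K.+1 => level n) (Ordinal nK)).
have /finset.set0Pn[x xg] := good_neq0 level_ltL.
exists (pt R x); split=> [i|n nK]; last by apply: (in_goodP level_ltL).
rewrite mxE divr_ge0 ?exprn_ge0 //= ler_pdivrMr ?exprn_gt0 // mul1r.
by rewrite -natrX ler_nat ltnW.
Qed.

Lemma closed_avoids n : closed [set v | avoids n v].
Proof.
pose D (v : 'rV[R]_d) := dist_int (affine_form (a n) (b n) v).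
pose E (v : 'rV[R]_d) := dist_int (4 ^+ level n * v ord0 i0 - (beta n)%:R / 2 - 8^-1).
have cD : closed [set v | eps * F n <= D v].
  apply: (@closed_comp _ _ D [set x | eps * F n <= x]); last exact: closed_ge.
  move=> v _; apply: (@continuous_comp _ _ _ (affine_form (a n) (b n)) (@dist_int R)).
    exact: continuous_affine_form.
  exact: continuous_dist_int.
have cE : closed [set v | E v <= 8^-1].
  apply: (@closed_comp _ _ E [set x | x <= 8^-1]); last exact: closed_le.
  move=> v _; apply: (@continuous_comp _ _ _ (fun v : 'rV[R]_d => 4 ^+ level n *
    v ord0 i0 - (beta n)%:R / 2 - 8^-1) (@dist_int R)); last exact: continuous_dist_int.
  apply: (@cvgB _ _ _ (nbhs v)); last exact: cvg_cst.
  apply: (@cvgB _ _ _ (nbhs v)); last exact: cvg_cst.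
  by apply: (@cvgM _ _ (nbhs v)); [exact: cvg_cst|exact: coord_continuous].
case Tn: (T n).
  rewrite (_ : mkset _ = [set v | eps * F n <= D v] `&` [set v | E v <= 8^-1]).
    exact: closedI.
  by apply/seteqP; split=> v /= [Dv Ev]; split=> //; exact: Ev.
rewrite (_ : mkset _ = [set v | eps * F n <= D v]) //.
by apply/seteqP; split=> v /=; [case|move=> Dv; split=> //; rewrite Tn].
Qed.

Lemma exists_avoids : exists v : 'rV[R]_d,
  (forall i, 0 <= v ord0 i <= 1) /\ forall n, (0 < n)%N -> avoids n v.
Proof.
have [v vP] := choice exists_avoids_upto.
have [|n|n K nK|w w01 wP] := @cube_limit R d v
    (fun n => [set w | (0 < n)%N -> avoids n w]).
- by move=> K; exact: (vP K).1.
- case: n => [|n]; first by rewrite (_ : mkset _ = setT) //; apply/seteqP.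
  rewrite (_ : mkset _ = [set w | avoids n.+1 w]); first exact: closed_avoids.
  by apply/seteqP; split=> w /=; [apply|].
- by move=> n0; apply: (vP K).2; rewrite n0.
by exists w; split.
Qed.

End FiniteStage.

(** * Choice of the constants and of the marked times; one point for each binary sequence *)

Section AvoidingFamily.
Variable R : realType.

(** The averages of [F] tend to 0. Past an index [N] with [F N < c / (2 * D)] the sum contributes at
    most half of [c * M]; the fixed initial part is absorbed by taking [M] large. *)
Lemma exists_scale (F : nat -> R) (c C D : R) (N0 : nat) :
  (forall n, (0 < n)%N -> 0 < F n) ->
  (forall n m, (0 < n <= m)%N -> F m <= F n) ->
  (forall delta, 0 < delta -> exists n, (0 < n)%N /\ F n < delta) ->
  0 < c -> 0 <= C -> 0 < D -> exists M, [/\ (0 < M)%N, (N0 <= M)%N &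
    D * (\sum_(1 <= j < M) F j + C) <= c * M%:R].
Proof.
move=> F0 Fle Fto c0 C0 D0.
have [N [N_gt0 FN]] := Fto (c / (2 * D)) (divr_gt0 c0 (mulr_gt0 (ltr0Sn _ 1) D0)).
pose S := \sum_(1 <= j < N) F j.
pose M := maxn (maxn N N0) (Num.truncn (2 * D * (S + C) / c)).+1.
have NM : (N <= M)%N by rewrite /M !leq_max leqnn.
exists M; split; [exact: leq_trans NM| by rewrite /M !leq_max leqnn orbT|].
rewrite (big_cat_nat N_gt0 NM) //= -/S.
have tail : \sum_(N <= j < M) F j <= c / (2 * D) * M%:R.
  apply: (@le_trans _ _ (\sum_(N <= j < M) (c / (2 * D)))).
    rewrite !big_nat; apply: ler_sum => j /andP[Nj _].
    by apply: le_trans (ltW FN); rewrite Fle // N_gt0.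
  rewrite sumr_const_nat -[leLHS]mulr_natr ler_wpM2l ?ler_nat ?leq_subr //.
  by rewrite ltW // divr_gt0 // mulr_gt0.
have head : 2 * D * (S + C) <= c * M%:R.
  rewrite [leRHS]mulrC -ler_pdivrMr //; apply: ltW.
  apply: lt_le_trans (truncnS_gt _) _; rewrite ler_nat.
  by rewrite /M leq_max leqnn orbT.
have := ler_wpM2l (ltW D0) tail.
have -> : D * (c / (2 * D) * M%:R) = c * M%:R / 2 by field; rewrite gt_eqF.
by lra.
Qed.

Lemma exists_avoiding_family d (i0 : 'I_d) (a : nat -> 'rV[R]_d) (b F r : nat -> R) (H : nat -> nat)
    (c C : R) (N0 : nat) :
  (forall n, (0 < n)%N -> 0 < F n) ->
  (forall n m, (0 < n <= m)%N -> F m <= F n) ->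
  (forall delta, 0 < delta -> exists n, (0 < n)%N /\ F n < delta) ->
  (forall n k, (0 < n)%N -> (k <= H n)%N -> \sum_(n <= j < k) F j <= C) ->
  (forall n m, (0 < n <= m)%N -> r n <= r m) ->
  d%:R <= r 1%N ->
  (forall n, (0 < n)%N -> forall i, `|a n ord0 i| <= r n) ->
  (forall n, (0 < n)%N -> exists i, r n <= d%:R * `|a n ord0 i|) ->
  (forall n, (0 < n)%N -> (n <= H n)%N) ->
  0 < c ->
  (forall n, (N0 <= n)%N -> c * n%:R * r n <= r (H n) * F n) ->
  exists eps, 0 < eps /\ exists g : (nat -> bool) -> 'rV[R]_d,
    injective (fun s => g s ord0 i0) /\ forall s, (forall i, 0 <= g s ord0 i <= 1) /\
    forall n, (0 < n)%N -> eps * F n <= dist_int (affine_form (a n) (b n) (g s)).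
Proof.
move=> F0 Fle Fto sumF rle r1 a_le a_ge H_ge c0 growth.
have d0 : 0 < d%:R :> R by rewrite ltr0n (leq_ltn_trans _ (ltn_ord i0)).
pose C' := Num.max C (F 1%N).
have C'0 : 0 <= C' by rewrite le_max (ltW (F0 1%N isT)) orbT.
have [M [M0 N0M Mle]] := @exists_scale F c C' (320 * (16 * d%:R ^+ 2)) N0 F0 Fle Fto c0 C'0
  (mulr_gt0 (ltr0Sn _ 319) (mulr_gt0 (ltr0Sn _ 15) (exprn_gt0 2 d0))).
have cM0 : 0 < c * M%:R by rewrite mulr_gt0 // ltr0n.
(* This turns [M_large] into an equality, and the factor [320 * (16 * d ^ 2)] passed to
   [exists_scale] is what [eps_small] then requires. *)
pose eps := 16 * d%:R ^+ 2 / (c * M%:R).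
have eps0 : 0 < eps by rewrite divr_gt0 // mulr_gt0 // exprn_gt0.
(* Marked times: each lies beyond [H] of the previous one, which is the sparsity required of [T]. *)
pose tau := fix tau n := if n is k.+1 then (H (tau k)).+1 else M.
have tau_ge k : (M <= tau k)%N.
  elim: k => //= k IH; apply: leqW; apply: leq_trans IH _.
  by apply: H_ge; case: k => //= k; exact: leq_trans M0 _.
have tau_gt0 k : (0 < tau k)%N by exact: leq_trans M0 _.
have tau_lt k k' : (k < k')%N -> (H (tau k) < tau k')%N.
  elim: k' => // k' IH; rewrite ltnS leq_eqVlt => /predU1P[->//|/IH lt].
  by apply: ltn_trans lt _; rewrite /= ltnS H_ge.
have tau_inj : injective tau.
  move=> k k' e; case: (ltngtP k k') => // /tau_lt; rewrite ?e -?e ltnNge H_ge //.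
pose T n := `[< exists k, tau k = n >].
pose beta (s : nat -> bool) n := `[< exists k, tau k = n /\ s k >].
have betaE s k : beta s (tau k) = s k.
  by apply/asboolP/idP => [[k' [/tau_inj->]]//|sk]; exists k.
have T_ge n : T n -> (M <= n)%N by move=> /asboolP[k <-].
have T_sparse j k : T j -> T k -> (j < k)%N -> (H j < k)%N.
  move=> /asboolP[k1 <-] /asboolP[k2 <-] lt12.
  case: (ltngtP k1 k2) => [k12|k21|e]; first exact: tau_lt.
    have := leq_trans (H_ge _ (tau_gt0 k2)) (ltnW (tau_lt _ _ k21)).
    by rewrite leqNgt lt12.
  by rewrite e ltnn in lt12.
have sumF' n k : (0 < n)%N -> (k <= H n)%N -> \sum_(n <= j < k) F j <= C'.
  by move=> n0 kH; rewrite le_max sumF.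
have F1C : F 1%N <= C' by rewrite le_max lexx orbT.
have growthM n : (M <= n)%N -> c * n%:R * r n <= r (H n) * F n.
  by move=> Mn; apply: growth; exact: leq_trans Mn.
have M_large : 16 * d%:R ^+ 2 <= c * M%:R * eps.
  by rewrite /eps [leRHS]mulrC divfK // gt_eqF.
have eps_small : 320 * (eps * (\sum_(1 <= j < M) F j + C')) <= 1.
  rewrite /eps mulrAC mulrA ler_pdivrMr // mul1r; move: Mle; lra.
have ex s := @exists_avoids R d i0 a b F r H c C' eps M F0 Fle sumF' F1C rle r1 a_le a_ge
  H_ge c0 growthM M0 eps0 M_large eps_small T (beta s) T_ge T_sparse.
have [g gP] := choice ex.
exists eps; split=> //; exists g; split; last first.
  by move=> s; split=> [|n n0]; [exact: (gP s).1|have [] := (gP s).2 n n0].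
move=> s s' e; apply/funext => k.
have Tk : T (tau k) by apply/asboolP; exists k.
have [_ /(_ Tk)] := (gP s).2 _ (tau_gt0 k).
have [_ /(_ Tk)] := (gP s').2 _ (tau_gt0 k).
rewrite !betaE e; set x := _ * _.
(* Modulo 1, the closed intervals of radius 1/8 about 1/8 and 5/8 are disjoint. Any radius strictly
   between 1/8 and 1/4, here 1/6, yields explicit nearby integers and still separates them. *)
have far (y : R) : dist_int (y - 8^-1) <= 8^-1 -> dist_int (y - 1 / 2 - 8^-1) <= 8^-1 -> False.
  move=> h1 h2.
  have [j1 hj1] : exists k : int, `|y - 8^-1 - k%:~R| < 6^-1.
    by apply: dist_int_ltP; apply: le_lt_trans h1 _; lra.
  have [j2 hj2] : exists k : int, `|y - 1 / 2 - 8^-1 - k%:~R| < 6^-1.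
    by apply: dist_int_ltP; apply: le_lt_trans h2 _; lra.
  move: hj1 hj2; rewrite !ltr_norml => /andP[u1 u2] /andP[v1 v2].
  have w1 : (j2 < j1)%R by rewrite -(ltr_int R); lra.
  have w2 : (j1 < j2 + 1)%R by rewrite -(ltr_int R) intrD; lra.
  by move: w2; rewrite ltzD1 leNgt w1.
have digit0 (y : R) : y - false%:R / 2 - 8^-1 = y - 8^-1 by rewrite mul0r subr0.
case: (s k) (s' k) => [] [] //; rewrite digit0 => h h'; exfalso.
  exact: far h h'.
exact: far h' h.
Qed.

End AvoidingFamily.

(** * Comparison of the p-norm with the largest coordinate *)

Section Lpnorm.
Variables (R : realType) (d : nat).
Implicit Types (p : \bar R) (v : 'rV[R]_d).

Lemma coord_le_lpnorm p v i : (1 <= p)%E -> `|v ord0 i| <= lpnorm p v.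
Proof.
case: p => [r| |] //= r1; last first.
  exact: (@le_bigmax_cond _ _ _ 0 i xpredT (fun i => `|v ord0 i|)).
rewrite lee_fin in r1; have r0 : 0 < r by exact: lt_le_trans r1.
have rn0 : r != 0 by rewrite gt_eqF.
rewrite -[leLHS]powRr1 // -[X in _ `^ X](mulfV rn0) powRrM.
apply: ge0_ler_powR; rewrite ?nnegrE ?invr_ge0 ?powR_ge0 ?(ltW r0) //.
  by apply: sumr_ge0 => j _; exact: powR_ge0.
rewrite (bigD1 i) //= lerDl.
by apply: sumr_ge0 => j _; exact: powR_ge0.
Qed.

(** For a coordinate of largest modulus and finite [p], the norm is at most [d ^ (1 / p)] times that
    modulus, and [d ^ (1 / p) <= d]. *)
Lemma lpnorm_le_coord p v : (0 < d)%N -> (1 <= p)%E ->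
  exists i, lpnorm p v <= d%:R * `|v ord0 i|.
Proof.
move=> d0 p1; have d1 : 1 <= d%:R :> R by rewrite ler1n.
have [i _ maxE] := @eq_bigmax _ R _ 0 (Ordinal d0) xpredT (fun i => `|v ord0 i|)
  isT (fun i _ => normr_ge0 _).
have vi j : `|v ord0 j| <= `|v ord0 i|.
  by rewrite -maxE; exact: (@le_bigmax_cond _ _ _ 0 j xpredT (fun i => `|v ord0 i|)).
exists i; case: p p1 => [r| |] //= r1; last by rewrite maxE ler_peMl.
rewrite lee_fin in r1; have r0 : 0 < r by exact: lt_le_trans r1.
have S0 : 0 <= \sum_(j < d) `|v ord0 j| `^ r.
  by apply: sumr_ge0 => j _; exact: powR_ge0.
apply: (@le_trans _ _ ((d%:R * `|v ord0 i| `^ r) `^ r^-1)).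
  apply: ge0_ler_powR; rewrite ?nnegrE ?invr_ge0 ?mulr_ge0 ?powR_ge0 ?(ltW r0) //.
  rewrite mulr_natl -[X in _ *+ X]card_ord -sumr_const; apply: ler_sum => j _.
  by apply: ge0_ler_powR; rewrite ?nnegrE ?(ltW r0).
rewrite powRM ?powR_ge0 ?(le_trans _ d1) // -powRrM mulfV ?gt_eqF // powRr1 //.
by rewrite ler_wpM2r // ler1_powR // invf_le1.
Qed.

End Lpnorm.

(** * Positive lower limits, and comparison of sums with integrals *)

Section Limits.
Variable R : realType.

Lemma limn_einf_gt0P (u : nat -> \bar R) : (0 < limn_einf u)%E <->
  exists c : R, 0 < c /\ exists N, forall n, (N <= n)%N -> (c%:E <= u n)%E.
Proof.
rewrite limn_einf_lim; split=> [lim0|[c [c0 [N cN]]]].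
  have [N einf0] : exists N, (0 < einfs u N)%E.
    apply: contrapT => /forallNP noN; move: lim0; apply/negP; rewrite -leNgt.
    apply: lime_le; first exact: is_cvg_einfs.
    by apply: nearW => n; rewrite leNgt; apply/negP.
  have [c c0 cle] : exists2 c : R, 0 < c & (c%:E <= einfs u N)%E.
    case: (einfs u N) einf0 => [x| |] // x0; last by exists 1; rewrite ?leey.
    by exists x; rewrite -?lte_fin.
  exists c; split=> //; exists N => n Nn; apply: le_trans cle _.
  by apply: ereal_inf_lbound; exists n.
have cE : (0 < c%:E)%E by rewrite lte_fin.
apply: lt_le_trans cE _; apply: lime_ge; first exact: is_cvg_einfs.
exists N => // n /= Nn; apply: le_ereal_inf_tmp => _ [k /= nk <-].
by apply: cN; exact: leq_trans nk.
Qed.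

Lemma sum_inv_le_integral (f : R -> R) (n k : nat) (y : R) :
  pos_on_ge1 f -> nondecreasing_on_ge1 f -> (0 < n)%N -> k%:R <= y ->
  ((\sum_(n <= j < k) (f j.+1%:R)^-1)%:E <=
   \int[@lebesgue_measure R]_(x in `[n%:R, y]) ((f x)^-1)%:E)%E.
Proof.
move=> f0 fle n0 ky.
(* Extending [1 / f] by a constant to the left of 1 makes it monotone on the whole line, hence
   measurable. *)
pose G (x : R) := (f (Num.max 1 x))^-1.
have G_ge0 x : 0 <= G x by rewrite invr_ge0 ltW // f0 // le_max lexx.
have G_noninc x z : x <= z -> G z <= G x.
  have ge1 (u : R) : 1 <= Num.max 1 u by rewrite le_max lexx.
  move=> xz; rewrite lef_pV2 ?posrE ?f0 //; apply: fle => //.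
  by rewrite ge_max ge1 le_max xz orbT.
have mG (D : set R) : measurable D -> measurable_fun D (EFin \o G).
  move=> mD; apply/measurable_EFinP.
  rewrite (_ : G = (fun x => - (- G x))); last by apply/funext => x; rewrite opprK.
  apply: measurableT_comp => //.
  by apply: nondecreasing_measurable => // x z xz; rewrite lerN2 G_noninc.
have n1 : 1 <= n%:R :> R by rewrite ler1n.
have -> : (\int[@lebesgue_measure R]_(x in `[n%:R, y]) ((f x)^-1)%:E =
    \int[@lebesgue_measure R]_(x in `[n%:R, y]) (G x)%:E)%E.
  apply: eq_integral => x; rewrite inE /= in_itv /= => /andP[nx _].
  by rewrite /G max_r // (le_trans n1).
have Gint0 D : (0 <= \int[@lebesgue_measure R]_(x in D) (G x)%:E)%E.
  by apply: integral_ge0 => x _; rewrite lee_fin.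
have [kn|/ltnW nk] := leqP k n; first by rewrite big_geq.
have step : ((\sum_(n <= j < k) (f j.+1%:R)^-1)%:E <=
   \int[@lebesgue_measure R]_(x in `[n%:R, k%:R[) (G x)%:E)%E.
  elim: k {ky} nk => [|k IH]; first by rewrite big_geq.
  rewrite leq_eqVlt => /predU1P[<-|nk]; first by rewrite big_geq.
  rewrite big_nat_recr // EFinD.
  rewrite (@itv_bndbnd_setU _ _ (BLeft n%:R) (BLeft k%:R) (BLeft k.+1%:R)); last 2 first.
  - by rewrite bnd_simp ler_nat.
  - by rewrite bnd_simp ler_nat.
  rewrite ge0_integral_setU //.
  - apply: leeD; first exact: IH.
    apply: (@le_trans _ _ (\int[@lebesgue_measure R]_(x in `[k%:R, k.+1%:R[)
        ((f k.+1%:R)^-1)%:E)%E).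
      rewrite integral_cst //= lebesgue_measure_itv /= lte_fin ltr_nat ltnSn.
      by rewrite -EFinD -natr1 addrAC subrr add0r mule1.
    apply: ge0_le_integral => //.
    + by move=> x _; rewrite lee_fin invr_ge0 ltW // f0 // ler1n.
    + exact: mG.
    + move=> x /=; rewrite in_itv /= => /andP[_ /ltW xk]; rewrite lee_fin.
      apply: (le_trans _ (G_noninc _ _ xk)).
      by rewrite /G max_r // ler1n.
  - by apply: mG; exact: measurableU.
  - by move=> x _; rewrite lee_fin.
  - rewrite disj_set2E; apply/eqP/seteqP; split=> // x [] /=.
    by rewrite !in_itv /= => /andP[_ lt] /andP[]; rewrite leNgt lt.
apply: le_trans step _; apply: ge0_subset_integral => //.
- exact: mG.
- by move=> x _; rewrite lee_fin.
- by move=> x /=; rewrite !in_itv /= => /andP[-> /ltW/le_trans->].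
Qed.

End Limits.

(** Rescales a cube of side [s] at [v] to the unit cube: the form keeps its shape, with coefficients
    multiplied by [s]. *)
Lemma affine_formD (R : realType) d (u v w : 'rV[R]_d) (e s : R) :
  affine_form u e (v + s *: w) = affine_form (s *: u) (affine_form u e v) w.
Proof.
rewrite /affine_form addrA -big_split /=; congr (_ + _).
by apply: eq_bigr => i _; rewrite !mxE; ring.
Qed.

(** * From the analytic assumptions to Cantor families in arbitrary cubes *)

Section Family.
Variables (R : realType) (d : nat) (p : \bar R).
Variables (a : nat -> 'rV[R]_d) (b : nat -> R) (f h : R -> R).
Hypothesis d_gt0 : (0 < d)%N.
Hypothesis p_ge1 : (1 <= p)%E.
Hypothesis R1_gt0 : 0 < lpnorm p (a 1%N).
Hypothesis R_ndecr : forall n : nat, (1 <= n)%N -> lpnorm p (a n) <= lpnorm p (a n.+1).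
Hypothesis f_pos : pos_on_ge1 f.
Hypothesis f_ndecr : nondecreasing_on_ge1 f.
Hypothesis h_ge : forall x : R, 1 <= x -> x <= h x.
Hypothesis f_lim : f x @[x --> +oo] --> +oo.
Hypothesis int_bounded :
  (ereal_sup [set \int[@lebesgue_measure R]_(u in `[x, h x]) ((f u)^-1)%:E
             | x in [set x : R | (1 <= x)%R]] < +oo)%E.
Hypothesis R_growth :
  (0 < limn_einf (fun n : nat =>
     (lpnorm p (a (Num.truncn (h n%:R)))
        / (n%:R * f n%:R * lpnorm p (a n)))%:E))%E.

Let r n := lpnorm p (a n).
Let F n : R := (f n%:R)^-1.
Let H n := Num.truncn (h n%:R).

Lemma norm_ndecr n m : (0 < n <= m)%N -> r n <= r m.
Proof.
elim: m => [|m IH]; first by case: n.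
move=> /andP[n0]; rewrite leq_eqVlt => /predU1P[->//|nm].
apply: le_trans (R_ndecr (leq_trans n0 nm)).
by apply: IH; rewrite n0.
Qed.

Lemma norm_gt0 n : (0 < n)%N -> 0 < r n.
Proof. by move=> n0; apply: lt_le_trans R1_gt0 _; exact: (@norm_ndecr 1%N). Qed.

Lemma inv_gt0 n : (0 < n)%N -> 0 < F n.
Proof. by move=> n0; rewrite invr_gt0 f_pos // ler1n. Qed.

Lemma inv_noninc n m : (0 < n <= m)%N -> F m <= F n.
Proof.
move=> /andP[n0 nm]; have m0 := leq_trans n0 nm.
by rewrite lef_pV2 ?posrE ?f_pos ?f_ndecr ?ler1n ?ler_nat.
Qed.

Lemma inv_to0 delta : 0 < delta -> exists n, (0 < n)%N /\ F n < delta.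
Proof.
move=> delta0; have /cvgryPgt /(_ delta^-1) [M [_ MP]] := f_lim.
exists (Num.truncn M).+1; split=> //.
rewrite -[ltRHS]invrK ltf_pV2 ?posrE ?invr_gt0 ?f_pos ?ler1n //.
by apply: MP; exact: truncnS_gt.
Qed.

Lemma le_truncn_h n : (0 < n)%N -> (n <= H n)%N.
Proof.
move=> n0; have n1 : 1 <= n%:R :> R by rewrite ler1n.
by rewrite truncn_ge_nat ?h_ge // (le_trans _ (h_ge n1)).
Qed.

Lemma sum_inv_bounded : exists C : R, forall n k, (0 < n)%N -> (k <= H n)%N ->
  \sum_(n <= j < k) F j <= C.
Proof.
have [I I_ge] : exists I : R, forall x : R, 1 <= x ->
    (\int[@lebesgue_measure R]_(u in `[x, h x]) ((f u)^-1)%:E <= I%:E)%E.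
  move: int_bounded; set A := [set _ | _ in _]; case E: (ereal_sup A) => [I| |] // _.
    by exists I => x x1; rewrite -E; apply: ereal_sup_ubound; exists x.
  exists 0 => x x1; apply: (@le_trans _ _ (ereal_sup A)); last by rewrite E leNye.
  by apply: ereal_sup_ubound; exists x.
(* The integral controls the terms after the first, because [1 / f (j + 1)] is compared with the
   integral over [[j, j + 1]]; the first term is at most [F 1]. *)
exists (F 1%N + I) => n k n0 kH.
have n1 : 1 <= n%:R :> R by rewrite ler1n.
have I0 : 0 <= I.
  rewrite -lee_fin; apply: le_trans (I_ge _ n1); apply: integral_ge0 => x /=.
  by rewrite in_itv /= => /andP[nx _]; rewrite lee_fin invr_ge0 ltW // f_pos // (le_trans n1).
have F1 := inv_gt0 (ltn0Sn 0).
have [kn|nk] := leqP k n; first by rewrite big_geq //; lra.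
case: k kH nk => // k kH; rewrite ltnS => nk.
rewrite big_nat_recl //; apply: lerD; first by apply: inv_noninc; rewrite n0.
rewrite -lee_fin; apply: le_trans (I_ge _ n1).
apply: sum_inv_le_integral => //.
apply: (@le_trans _ _ k.+1%:R); first by rewrite ler_nat.
by rewrite -truncn_ge_nat // (le_trans _ (h_ge n1)) // (le_trans _ n1).
Qed.

Lemma growth_bound : exists c, 0 < c /\ exists N, forall n, (N <= n)%N ->
  c * n%:R * r n <= r (H n) * F n.
Proof.
have [c [c0 [N cN]]] := (limn_einf_gt0P _).1 R_growth.
exists c; split=> //; exists (maxn N 1) => n; rewrite geq_max => /andP[Nn n0].
have := cN n Nn; rewrite lee_fin.
have n1 : 1 <= n%:R :> R by rewrite ler1n.
have fn0 := f_pos n1; have rn0 := norm_gt0 n0.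
have n0R : 0 < n%:R :> R by rewrite ltr0n.
rewrite ler_pdivlMr ?mulr_gt0 // => le.
by rewrite /F ler_pdivlMr // -!mulrA [r n * _]mulrC [n%:R * _]mulrA.
Qed.

(** Since [f n >= f 1], growth gives [r (H n) >= 2 * r n] once [c * n >= 2 / f 1]. Iterating [H]
    therefore adds at least [r 1] to the norm at each step. *)
Lemma norm_unbounded (B : R) : exists N, (0 < N)%N /\ B <= r N.
Proof.
have [c [c0 [N0 cN]]] := growth_bound.
have F1 := inv_gt0 (ltn0Sn 0).
pose m := maxn (maxn N0 1) (Num.truncn (2 * F 1%N / c)).+1.
have m0 : (0 < m)%N by rewrite /m !leq_max orbT.
have double n : (m <= n)%N -> 2 * r n <= r (H n).
  move=> mn; have n0 := leq_trans m0 mn.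
  have N0n : (N0 <= n)%N by apply: leq_trans mn; rewrite /m !leq_max leqnn.
  have cn : 2 * F 1%N <= c * n%:R.
    rewrite [leRHS]mulrC -ler_pdivrMr //; apply: le_trans (ltW (truncnS_gt _)) _.
    by rewrite ler_nat; apply: leq_trans mn; rewrite /m leq_max leqnn orbT.
  have rn := norm_gt0 n0; have rH := norm_gt0 (leq_trans n0 (le_truncn_h n0)).
  have := cN n N0n; have Fn1 : F n <= F 1%N by apply: inv_noninc; rewrite n0.
  have := ler_wpM2r (ltW rn) cn; have := ler_wpM2l (ltW rH) Fn1.
  move=> h1 h2 h3; rewrite -(ler_pM2r F1); move: h1 h2 h3; lra.
have pow k : exists n, (m <= n)%N /\ k%:R * r 1%N <= r n.
  elim: k => [|k [n [mn IH]]].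
    by exists m; rewrite mul0r ltW // norm_gt0.
  have n0 := leq_trans m0 mn; exists (H n); split; first exact: leq_trans (le_truncn_h n0).
  apply: le_trans (double n mn); rewrite -natr1 mulrDl mul1r.
  by have : r 1%N <= r n by [apply: norm_ndecr]; lra.
have [n [mn le_n]] := pow (Num.truncn (B / r 1%N)).+1.
exists n; split; first exact: leq_trans mn.
apply: le_trans le_n; rewrite -ler_pdivrMr //; exact/ltW/truncnS_gt.
Qed.

(* A whole Cantor family inside the cube [theta0 + [0, s]^d], where only the
   forms oscillating at scale [s] are controlled: [N] is chosen accordingly. *)
Lemma cube_family (i0 : 'I_d) (theta0 : 'rV[R]_d) (s : R) (N : nat) :
  0 < s -> (0 < N)%N -> d%:R <= s * r N ->
  exists eps, 0 < eps /\ exists g : (nat -> bool) -> 'rV[R]_d,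
    injective (fun x => g x ord0 i0) /\ forall x,
    (forall i, theta0 ord0 i <= g x ord0 i <= theta0 ord0 i + s) /\
    forall n, (N <= n)%N -> eps <= dist_int (affine_form (a n) (b n) (g x)) * f n%:R.
Proof.
move=> s0 N0 sN.
have [C sumF] := sum_inv_bounded; have [c [c0 [N1 cN]]] := growth_bound.
(* Forms before [N] are replaced by copies of the form [N], so that the norms stay monotone and the
   first one is at least [d] after rescaling. *)
pose a' n := s *: a (maxn n N).
pose b' n := affine_form (a (maxn n N)) (b (maxn n N)) theta0.
pose r' n := s * r (maxn n N).
have max_gt0 n : (0 < maxn n N)%N by rewrite leq_max N0 orbT.
have [|||||eps [eps0 [g [g_inj gP]]]] := @exists_avoiding_family R d i0 a' b' F r' H c C (maxn N N1)
   inv_gt0 inv_noninc inv_to0 sumF _ _ _ _ le_truncn_h c0 _.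
- move=> n m /andP[n0 nm]; rewrite /r' ler_pM2l // norm_ndecr // max_gt0 /=.
  by rewrite geq_max leq_maxr andbT leq_max nm.
- apply: (le_trans sN); rewrite ler_pM2l // norm_ndecr // N0 leq_maxr //.
- move=> n n0 i; rewrite /a' mxE normrM gtr0_norm // ler_pM2l //.
  exact: coord_le_lpnorm.
- move=> n n0; have [i ri] := lpnorm_le_coord (a (maxn n N)) d_gt0 p_ge1.
  by exists i; rewrite /a' mxE normrM gtr0_norm // mulrCA ler_pM2l.
- move=> n; rewrite geq_max => /andP[Nn N1n].
  have n0 := leq_trans N0 Nn.
  rewrite /r' (maxn_idPl Nn) (maxn_idPl (leq_trans Nn (le_truncn_h n0))).
  by rewrite mulrCA -mulrA ler_pM2l // cN.
exists eps; split=> //; exists (fun x => theta0 + s *: g x); split.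
  move=> x y /=; rewrite !mxE => /addrI /(mulfI (lt0r_neq0 s0)) /g_inj //.
move=> x; have [g01 gfar] := gP x; split.
  move=> i; rewrite !mxE lerDl lerD2l; have /andP[g0 g1] := g01 i.
  by rewrite mulr_ge0 ?(ltW s0) //= ler_piMr // ltW.
move=> n Nn; have n0 := leq_trans N0 Nn.
have := gfar n n0; rewrite /a' /b' (maxn_idPl Nn) -affine_formD /F.
by rewrite ler_pdivrMr // f_pos // ler1n.
Qed.

End Family.

(** * Cardinality of the continuum *)

Definition cuts (R : realType) d (v : 'rV[R]_d) (n : nat) : bool :=
  if unpickle n is Some (i, q) then ratr q < v ord0 (i : 'I_d) else false.

(** The sequence [cuts v] codes the Dedekind cuts of all coordinates of [v]; a rational between two
    distinct coordinates separates them. *)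
Lemma cuts_inj (R : realType) d : injective (@cuts R d).
Proof.
move=> v w e; apply/rowP => i; apply/eqP; rewrite -(ord1 ord0).
apply: contraT; rewrite neq_lt => vw.
have cut q : (ratr q < v ord0 i) = (ratr q < w ord0 i).
  by have := congr1 (fun c => c (pickle (i, q : rat))) e; rewrite /cuts !pickleK.
by move: vw => /orP[] /rat_in_itvoo[q]; rewrite in_itv /= => /andP[lt1 lt2];
  move: (cut q); rewrite ?lt2 ltNge (ltW lt1).
Qed.

(** The family [g] serves in both directions of Cantor-Bernstein: through [cuts] and the coordinate
    [i0] it injects vectors into the reals, and through [cuts] of constant vectors it injects the
    reals into [S]. *)
Lemma card_eq_reals (R : realType) d (S : set 'rV[R]_d) (i0 : 'I_d)
    (g : (nat -> bool) -> 'rV[R]_d) :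
  injective (fun x => g x ord0 i0) -> (forall x, S (g x)) -> (S #= [set: R])%card.
Proof.
move=> g_inj gS; apply: Cantor_Bernstein.
  apply/pcard_injP; exists (fun v => g (cuts v) ord0 i0).
  by move=> v w _ _ /g_inj /cuts_inj.
pose k (x : R) := g (cuts (const_mx x : 'rV[R]_d)).
have k_inj : injective k.
  move=> x y /(congr1 (fun v : 'rV[R]_d => v ord0 i0)) /g_inj /cuts_inj.
  by move=> /(congr1 (fun v : 'rV[R]_d => v ord0 i0)); rewrite !mxE.
have : (k @` [set: R] #= [set: R])%card by apply: inj_card_eq => x y _ _ /k_inj.
move=> /card_eqPle[_ le_k]; apply: card_le_trans le_k _.
by apply: subset_card_le => _ [x _ <-]; exact: gS.
Qed.

Theorem theorem3 (R : realType) (d : nat) (p : \bar R)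
  (a : nat -> 'rV[R]_d) (b : nat -> R) (f h : R -> R)
  (d_gt0 : (0 < d)%N)
  (p_ge1 : (1 <= p)%E)
  (R1_gt0 : 0 < lpnorm p (a 1%N))
  (R_ndecr : forall n : nat, (1 <= n)%N ->
     lpnorm p (a n) <= lpnorm p (a n.+1))
  (f_pos : pos_on_ge1 f) (f_ndecr : nondecreasing_on_ge1 f)
  (h_pos : pos_on_ge1 h) (h_ndecr : nondecreasing_on_ge1 h)
  (h_ge : forall x : R, 1 <= x -> x <= h x)
  (f_lim : f x @[x --> +oo] --> +oo)
  (int_bounded :
     (ereal_sup [set \int[@lebesgue_measure R]_(u in `[x, h x]) ((f u)^-1)%:E
                | x in [set x : R | (1 <= x)%R]] < +oo)%E)
  (R_growth :
     (0 < limn_einf (fun n : nat =>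
        (lpnorm p (a (Num.truncn (h n%:R)))
           / (n%:R * f n%:R * lpnorm p (a n)))%:E))%E) :
  ([set theta : 'rV[R]_d |
     (0 < inf [set dist_int (affine_form (a n) (b n) theta) * f n%:R
              | n in [set n : nat | (1 <= n)%N]])%R] #= [set: R])%card
  /\
  dense [set theta : 'rV[R]_d |
     (0 < limn_einf (fun n : nat =>
        (dist_int (affine_form (a n) (b n) theta) * f n%:R)%:E))%E].
Proof.
pose i0 := Ordinal d_gt0.
have d0 : 0 < d%:R :> R by rewrite ltr0n.
split.
  (* With this side already the first form oscillates enough, so [N = 1] is allowed and every
     [n >= 1] is controlled. *)
  have s0 : 0 < d%:R / lpnorm p (a 1%N) by rewrite divr_gt0.
  have [|eps [eps0 [g [g_inj gP]]]] := cube_family b d_gt0 p_ge1 R1_gt0 R_ndecr f_pos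
    f_ndecr h_ge f_lim int_bounded R_growth i0 0 (N := 1%N) s0 isT.
    by rewrite divfK // gt_eqF.
  apply: (card_eq_reals g_inj) => x /=; apply: lt_le_trans eps0 _.
  apply: lb_le_inf; first by eexists; exists 1%N.
  by move=> _ [n n1 <-]; exact: (gP x).2.
move=> O [theta0 O0] openO.
have /nbhs_ballP[e /= e0 eO] := open_nbhs_nbhs (conj openO O0).
(* A cube of side [e / 2] at [theta0] fits in the ball of radius [e] for the max norm. Only the
   forms from some [N] on are controlled there, which is enough for the lower limit. *)
have s0 : 0 < e / 2 by rewrite divr_gt0.
have [N [N0 rN]] := norm_unbounded R1_gt0 R_ndecr f_pos f_ndecr h_ge R_growth
  (d%:R / (e / 2)).
have [|eps [eps0 [g [_ gP]]]] := cube_family b d_gt0 p_ge1 R1_gt0 R_ndecr f_pos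
    f_ndecr h_ge f_lim int_bounded R_growth i0 theta0 s0 N0.
  by rewrite mulrC -ler_pdivrMr.
have [g_cube g_far] := gP xpred0.
exists (g xpred0); split.
  apply: eO; split=> // i j; rewrite (ord1 i) /ball /= ltr_norml.
  by have /andP[? ?] := g_cube j; apply/andP; split; lra.
by apply/limn_einf_gt0P; exists eps; split=> //; exists N => n Nn; rewrite lee_fin g_far.
Qed.
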